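(* Let $(M,g)$ be a semi-Riemannian manifold, $f\in C^\infty(M)$, $V=-\mathrm{grad}\, f$ (gradient with respect to $g$) and $\tilde g=e^{2f}g$. Then $$\mathcal{R}^V=e^{-2f}\mathcal{R}^{\tilde g},\qquad \mathrm{Ric}^V=\mathrm{Ric}^{\tilde g},\qquad s^V=e^{2f}s^{\tilde g},$$ where $\mathcal{R}^V,\mathcal{R}^{\tilde g}$ are regarded as $(4,0)$-tensors (lowered with $g$ and $\tilde g$, respectively). In particular, $(M,g)$ is $(-\mathrm{grad}\,f)$-flat (resp. $(-\mathrm{grad}\,f)$-Einstein, resp. $(-\mathrm{grad}\,f)$-Ricci flat) if and only if $(M,\tilde g)$ is flat (resp. Einstein, resp. Ricci flat).
   Context: Let $\nabla^g$ be the Levi-Civita connection of $(M,g)$. The metric connection with vectorial torsion $V$ is $\nabla_XY=\nabla^g_XY+g(X,Y)V-g(V,Y)X$. Its curvature is $\mathcal{R}^V(X,Y)Z=\nabla_X\nabla_YZ-\nabla_Y\nabla_XZ-\nabla_{[X,Y]}Z$, with $\mathcal{R}^V(X,Y,Z,W)=g(\mathcal{R}^V(X,Y)Z,W)$. For a $g$-orthonormal basis with $g(e_i,e_j)=\varepsilon_i\delta_{ij}$, $\varepsilon_i=\pm1$: $\mathrm{Ric}^V(X,Y)=\sum_i\varepsilon_i g(\mathcal{R}^V(X,e_i)e_i,Y)$ and $s^V=\sum_i\varepsilon_i\mathrm{Ric}^V(e_i,e_i)$. $\mathcal{R}^{\tilde g},\mathrm{Ric}^{\tilde g},s^{\tilde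 g}$ are the corresponding quantities of the Levi-Civita connection of $\tilde g$, with $\mathcal R^{\tilde g}(X,Y,Z,W)=\tilde g(\mathcal R^{\tilde g}(X,Y)Z,W)$. $(M,g)$ is called $V$-flat if $\mathcal{R}^V=0$, $V$-Ricci flat if $\mathrm{Ric}^V=0$, and $V$-Einstein if $\mathrm{Ric}^V$ is a (smooth function) multiple of $g$; likewise ''Einstein'' for $\tilde g$ means that $\mathrm{Ric}^{\tilde g}$ is a function multiple of $\tilde g$. *)

(* Defs.v *)
From HB Require Import structures.
From mathcomp Require Import all_boot all_order all_algebra.
From mathcomp Require Import all_classical all_reals all_analysis.
From mathcomp Require Import ring.

Set Implicit Arguments.
Unset Strict Implicit.
Unset Printing Implicit Defensive.

Import Order.TTheory GRing.Theory Num.Theory.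
Import numFieldNormedType.Exports.

Local Open Scope classical_set_scope.
Local Open Scope ring_scope.

Section smooth_on.
Variables (R : realType) (n : nat).
Implicit Types (U : set 'rV[R]_n) (h : 'rV[R]_n -> R).

(* C^k on U (meant for open U) through iterated partial derivatives. *)
Fixpoint Ck (k : nat) U h : Prop :=
  (forall x, U x -> {for x, continuous h}) /\
  if k is k'.+1 then
    forall i : 'I_n, exists2 dh : 'rV[R]_n -> R,
      forall x, U x -> is_derive x (delta_mx 0 i : 'rV[R]_n) h (dh x)
      & Ck k' U dh
  else True.

Definition smooth_on U h : Prop := forall k, Ck k U h.

Lemma Ck_continuous k U h : Ck k U h -> forall x, U x -> {for x, continuous h}.
Proof. by case: k => [|k] []. Qed.

Lemma CkW k U h : Ck k.+1 U h -> Ck k U h.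
Proof.
elim: k h => [|k IHk] h [hc hd]; split => // i.
by have [dh dhE /IHk] := hd i; exists dh.
Qed.

Lemma Ck_cst k U (a : R) : Ck k U (fun=> a).
Proof.
elim: k a => [|k IHk] a; split => //; try by move=> x _; exact: cst_continuous.
by move=> i; exists (fun=> 0) => // x _; exact: is_derive_cst.
Qed.

Lemma CkD k U h1 h2 : Ck k U h1 -> Ck k U h2 -> Ck k U (h1 + h2).
Proof.
elim: k h1 h2 => [|k IHk] h1 h2 [c1 d1] [c2 d2]; split => //.
- by move=> x Ux; apply: continuousD; [exact: c1|exact: c2].
- by move=> x Ux; apply: continuousD; [exact: c1|exact: c2].
- move=> i; have [d1h E1 C1] := d1 i; have [d2h E2 C2] := d2 i.
  exists (d1h + d2h); last exact: IHk.
  by move=> x Ux; apply: is_deriveD; [exact: E1|exact: E2].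
Qed.

Lemma CkM k U h1 h2 : Ck k U h1 -> Ck k U h2 -> Ck k U (h1 * h2).
Proof.
elim: k h1 h2 => [|k IHk] h1 h2 C1 C2.
  by split=> // x Ux; apply: continuousM; [exact: (C1.1 x)|exact: (C2.1 x)].
split=> [x Ux|i].
  by apply: continuousM; [exact: (C1.1 x)|exact: (C2.1 x)].
have [d1h E1 C1'] := C1.2 i; have [d2h E2 C2'] := C2.2 i.
exists (h1 * d2h + h2 * d1h).
  by move=> x Ux; apply: is_deriveM; [exact: E1|exact: E2].
by apply: CkD; apply: IHk => //; exact: CkW.
Qed.

Lemma is_derive_expR_comp h (x v : 'rV[R]_n) (d : R) :
  is_derive x v h d -> is_derive x v (expR \o h) (expR (h x) * d).
Proof.
move=> [hd <-].
pose l (t : R) := h (t *: v + x).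
have l0 : l 0 = h x by rewrite /l scale0r add0r.
have ld : is_derive (0 : R) (1 : R) l ('D_v h x).
  have shE :
      (fun t : R => t^-1 *: ((l \o shift 0) (t *: (1 : R)) - l 0)) =
      (fun t : R => t^-1 *: ((h \o shift x) (t *: v) - h x)).
    by apply/funext => t; rewrite l0 /l /= addr0 /GRing.scale /= mulr1.
  by split; rewrite ?/derivable ?/derive shE.
have [ed eE] : is_derive (0 : R) (1 : R) (expR \o l) (expR (h x) * 'D_v h x).
  by rewrite -l0; apply: is_derive1_comp.
have shE :
    (fun t : R => t^-1 *:
       (((expR \o l) \o shift 0) (t *: (1 : R)) - (expR \o l) 0)) =
    (fun t : R => t^-1 *:
       (((expR \o h) \o shift x) (t *: v) - (expR \o h) x)).
  by apply/funext => t; rewrite /= l0 /l /= addr0 /GRing.scale /= mulr1.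
by split; [move: ed; rewrite /derivable shE|move: eE; rewrite /derive shE].
Qed.

Lemma Ck_expR k U h : Ck k U h -> Ck k U (expR \o h).
Proof.
elim: k h => [|k IHk] h C.
  split=> // x Ux; apply: continuous_comp; first exact: (C.1 x).
  exact: continuous_expR.
split=> [x Ux|i].
  by apply: continuous_comp; [exact: (C.1 x)|exact: continuous_expR].
have [dh dhE C'] := C.2 i; exists ((expR \o h) * dh).
  by move=> x Ux; apply: is_derive_expR_comp; exact: dhE.
by apply: CkM => //; apply: IHk; exact: CkW.
Qed.

End smooth_on.

Record chart (R : realType) (n : nat) (M : topologicalType) := Chart {
  chart_dom : set M ;
  chart_cod : set 'rV[R]_n ;
  chart_fun : M -> 'rV[R]_n ;
  chart_inv : 'rV[R]_n -> M ;
  open_chart_dom : open chart_dom ;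
  open_chart_cod : open chart_cod ;
  chart_funP : forall p, chart_dom p -> chart_cod (chart_fun p) ;
  chart_invP : forall x, chart_cod x -> chart_dom (chart_inv x) ;
  chart_funK : forall p, chart_dom p -> chart_inv (chart_fun p) = p ;
  chart_invK : forall x, chart_cod x -> chart_fun (chart_inv x) = x ;
  continuous_chart_fun :
    forall p, chart_dom p -> {for p, continuous chart_fun} ;
  continuous_chart_inv :
    forall x, chart_cod x -> {for x, continuous chart_inv} }.

Definition chart_compatible (R : realType) n (M : topologicalType)
    (c c' : chart R n M) : Prop :=
  forall j : 'I_n,
    smooth_on (chart_cod c `&` chart_inv c @^-1` chart_dom c')
              (fun x => chart_fun c' (chart_inv c x) 0 j).

(* Smooth n-dimensional manifolds; the atlas is not required to be maximal. *)
Record manifold (R : realType) (n : nat) := Manifold {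
  manifold_space :> topologicalType ;
  manifold_hausdorff : hausdorff_space manifold_space ;
  manifold_second_countable : @second_countable manifold_space ;
  atlas : set (chart R n manifold_space) ;
  atlas_cover : forall p : manifold_space, exists2 c, atlas c & chart_dom c p ;
  atlas_compatible :
    forall c c', atlas c -> atlas c' -> chart_compatible c c' }.

Section smooth_functions.
Variables (R : realType) (n : nat) (M : manifold R n).

Definition smooth : {pred M -> R} := fun f =>
  `[< forall c, @atlas R n M c -> smooth_on (chart_cod c) (f \o chart_inv c) >].

Lemma smooth_subring_closed : subring_closed smooth.
Proof.
split; first by apply/asboolP => c _ k; exact: Ck_cst.
- move=> f h /asboolP fs /asboolP hs; apply/asboolP => c Ac k.
  have -> : (f - h) \o chart_inv c =
      (f \o chart_inv c) + (fun=> -1) * (h \o chart_inv c).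
    by apply/funext => x; rewrite !fctE mulN1r.
  apply: CkD; first exact: fs.
  by apply: CkM; [exact: Ck_cst|exact: hs].
- move=> f h /asboolP fs /asboolP hs; apply/asboolP => c Ac k.
  by apply: CkM; [exact: fs|exact: hs].
Qed.

HB.instance Definition _ :=
  GRing.isSubringClosed.Build (M -> R) smooth smooth_subring_closed.

Lemma smooth_scaler_closed : GRing.scaler_closed smooth.
Proof.
move=> a f /asboolP fs; apply/asboolP => c Ac k.
by apply: (@CkM _ _ k _ (fun=> a)); [exact: Ck_cst|exact: fs].
Qed.

HB.instance Definition _ :=
  GRing.isScaleClosed.Build R (M -> R) smooth smooth_scaler_closed.

(* The ring C^oo(M). *)
Record smoothfun := SmoothFun {
  smoothfun_val :> M -> R ;
  smoothfunP : smoothfun_val \in smooth }.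

HB.instance Definition _ := [isSub for smoothfun_val].
HB.instance Definition _ := [Choice of smoothfun by <:].
HB.instance Definition _ :=
  GRing.SubChoice_isSubComPzRing.Build (M -> R) smooth smoothfun
    smooth_subring_closed.
HB.instance Definition _ := [SubZmodule_isSubLmodule of smoothfun by <:].

Lemma smooth_expR (f : smoothfun) : (expR \o f) \in smooth.
Proof.
apply/asboolP => c Ac k; apply: (@Ck_expR _ _ k _ (f \o chart_inv c)).
by have /asboolP := smoothfunP f; exact.
Qed.

Definition sexp (f : smoothfun) : smoothfun := SmoothFun (smooth_expR f).

End smooth_functions.

Section vector_fields.
Variables (R : realType) (n : nat) (M : manifold R n).
Local Notation Cinf := (smoothfun M).

(* Smooth vector fields, as the derivations of C^oo(M): X f is the derivative *)
(* of f along X, and the value X_p in T_pM is the point derivation            *)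
(* f |-> X f p.                                                               *)
Record vfield := VField {
  vfield_fun :> Cinf -> Cinf ;
  vfield_linear : forall (a : R) (f h : Cinf),
    vfield_fun (a *: f + h) = a *: vfield_fun f + vfield_fun h ;
  vfield_leibniz : forall f h : Cinf,
    vfield_fun (f * h) = vfield_fun f * h + f * vfield_fun h }.

Lemma vfield_eqP (X Y : vfield) : (forall f, X f = Y f) -> X = Y.
Proof.
case: X Y => [X X1 X2] [Y Y1 Y2] /= /funext XY; move: X1 X2; rewrite XY.
by move=> X1 X2; congr VField; exact: Prop_irrelevance.
Qed.

HB.instance Definition _ := gen_eqMixin vfield.
HB.instance Definition _ := gen_choiceMixin vfield.

Lemma smooth_scaleAl (a : R) (f h : Cinf) : a *: f * h = a *: (f * h).
Proof.
apply/val_inj/funext => p.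
by change (a * f p * h p = a * (f p * h p)); rewrite mulrA.
Qed.

Lemma smooth_scaleAr (a : R) (f h : Cinf) : f * (a *: h) = a *: (f * h).
Proof. by rewrite mulrC smooth_scaleAl [h * f]mulrC. Qed.

Fact vfield0_linear (a : R) (f h : Cinf) : (0 : Cinf) = a *: 0 + 0.
Proof. by rewrite scaler0 addr0. Qed.
Fact vfield0_leibniz (f h : Cinf) : 0 = 0 * h + f * 0.
Proof. by rewrite mul0r mulr0 addr0. Qed.
Definition vfield0 : vfield := VField vfield0_linear vfield0_leibniz.

Fact vfieldN_linear (X : vfield) (a : R) (f h : Cinf) :
  - X (a *: f + h) = a *: (- X f) + (- X h).
Proof. by rewrite vfield_linear opprD scalerN. Qed.
Fact vfieldN_leibniz (X : vfield) (f h : Cinf) :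
  - X (f * h) = - X f * h + f * (- X h).
Proof. by rewrite vfield_leibniz opprD mulNr mulrN. Qed.
Definition vfieldN X : vfield :=
  VField (vfieldN_linear X) (vfieldN_leibniz X).

Fact vfieldD_linear (X Y : vfield) (a : R) (f h : Cinf) :
  X (a *: f + h) + Y (a *: f + h) = a *: (X f + Y f) + (X h + Y h).
Proof. by rewrite !vfield_linear scalerDr addrACA. Qed.
Fact vfieldD_leibniz (X Y : vfield) (f h : Cinf) :
  X (f * h) + Y (f * h) = (X f + Y f) * h + f * (X h + Y h).
Proof. by rewrite !vfield_leibniz mulrDl mulrDr addrACA. Qed.
Definition vfieldD X Y : vfield :=
  VField (vfieldD_linear X Y) (vfieldD_leibniz X Y).

Fact vfieldZ_linear (k : Cinf) (X : vfield) (a : R) (f h : Cinf) :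
  k * X (a *: f + h) = a *: (k * X f) + k * X h.
Proof. by rewrite vfield_linear mulrDr smooth_scaleAr. Qed.
Fact vfieldZ_leibniz (k : Cinf) (X : vfield) (f h : Cinf) :
  k * X (f * h) = k * X f * h + f * (k * X h).
Proof. by rewrite vfield_leibniz mulrDr mulrA mulrCA. Qed.
Definition vfieldZ k X : vfield :=
  VField (vfieldZ_linear k X) (vfieldZ_leibniz k X).

Fact vfieldDA : associative vfieldD.
Proof. by move=> X Y Z; apply: vfield_eqP => f /=; rewrite addrA. Qed.
Fact vfieldDC : commutative vfieldD.
Proof. by move=> X Y; apply: vfield_eqP => f /=; rewrite addrC. Qed.
Fact vfield0D : left_id vfield0 vfieldD.
Proof. by move=> X; apply: vfield_eqP => f /=; rewrite add0r. Qed.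
Fact vfieldND : left_inverse vfield0 vfieldN vfieldD.
Proof. by move=> X; apply: vfield_eqP => f /=; rewrite addNr. Qed.

HB.instance Definition _ :=
  GRing.isZmodule.Build vfield vfieldDA vfieldDC vfield0D vfieldND.

Fact vfieldZA (k l : Cinf) (X : vfield) :
  vfieldZ k (vfieldZ l X) = vfieldZ (k * l) X.
Proof. by apply: vfield_eqP => f /=; rewrite mulrA. Qed.
Fact vfieldZ1 : left_id 1 vfieldZ.
Proof. by move=> X; apply: vfield_eqP => f /=; rewrite mul1r. Qed.
Fact vfieldZDr : right_distributive vfieldZ +%R.
Proof. by move=> k X Y; apply: vfield_eqP => f /=; rewrite mulrDr. Qed.
Fact vfieldZDl (X : vfield) : {morph vfieldZ^~ X : k l / k + l}.
Proof. by move=> k l; apply: vfield_eqP => f /=; rewrite mulrDl. Qed.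

HB.instance Definition _ :=
  GRing.Zmodule_isLmodule.Build Cinf vfield vfieldZA vfieldZ1 vfieldZDr
    vfieldZDl.

Fact bracket_linear (X Y : vfield) (a : R) (f h : Cinf) :
  X (Y (a *: f + h)) - Y (X (a *: f + h)) =
  a *: (X (Y f) - Y (X f)) + (X (Y h) - Y (X h)).
Proof. by rewrite !vfield_linear opprD addrACA scalerBr. Qed.
Fact bracket_leibniz (X Y : vfield) (f h : Cinf) :
  X (Y (f * h)) - Y (X (f * h)) =
  (X (Y f) - Y (X f)) * h + f * (X (Y h) - Y (X h)).
Proof.
have vD (Z : vfield) u w : Z (u + w) = Z u + Z w.
  by rewrite -{1}[u]scale1r vfield_linear scale1r.
rewrite !vfield_leibniz !vD !vfield_leibniz.
apply/val_inj/funext => p.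
change (X (Y f) p * h p + Y f p * X h p + (X f p * Y h p + f p * X (Y h) p)
  - (Y (X f) p * h p + X f p * Y h p + (Y f p * X h p + f p * Y (X h) p)) =
  (X (Y f) p - Y (X f) p) * h p + f p * (X (Y h) p - Y (X h) p)).
ring.
Qed.
Definition bracket X Y : vfield :=
  VField (bracket_linear X Y) (bracket_leibniz X Y).

(* Elements of T_pM. *)
Definition tangent_at (p : M) (v : Cinf -> R) : Prop :=
  (forall (a : R) (f h : Cinf), v (a *: f + h) = a * v f + v h) /\
  (forall f h : Cinf, v (f * h) = v f * h p + f p * v h).

(* The values at p of E_1, ..., E_n form a basis of T_pM which is orthonormal *)
(* for g, with g(E_i, E_j)(p) = eps_i delta_ij and eps_i = (-1) ^+ eps i;     *)
(* linear independence follows from the first condition.                      *)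
Definition orthonormal_basis_at (g : vfield -> vfield -> Cinf) (p : M)
    (E : 'I_n -> vfield) (eps : 'I_n -> bool) : Prop :=
  (forall i j, g (E i) (E j) p = if i == j then (-1) ^+ eps i else 0) /\
  (forall v, tangent_at p v ->
     exists a : 'I_n -> R, forall f, v f = \sum_i a i * E i f p).

(* Semi-Riemannian metrics, given by their action on vector fields: g(X, Y)(p) *)
(* depends only on X_p and Y_p, and the resulting forms on the tangent spaces *)
(* T_pM are nondegenerate and of constant index (the number of minus signs in *)
(* an orthonormal basis).                                                     *)
Record metric := Metric {
  metric_form :> vfield -> vfield -> Cinf ;
  metric_linear : forall (h : Cinf) (X Y Z : vfield),
    metric_form (h *: X + Y) Z = h * metric_form X Z + metric_form Y Z ;
  metric_sym : forall X Y, metric_form X Y = metric_form Y X ;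
  metric_pointwise : forall (p : M) (X Y : vfield),
    (forall f, X f p = 0) -> metric_form X Y p = 0 ;
  metric_nondegenerate : forall (p : M) (X : vfield),
    (forall Y, metric_form X Y p = 0) -> forall f, X f p = 0 ;
  metric_index : nat ;
  metric_indexP : forall p : M, exists E eps,
    orthonormal_basis_at metric_form p E eps /\
    #|[set i | eps i]%SET| = metric_index }.

Section conformal_change.
Variables (f : Cinf) (g : metric).

Definition conformal_form (X Y : vfield) : Cinf := sexp (f *+ 2) * g X Y.

Fact conformal_linear (h : Cinf) (X Y Z : vfield) :
  conformal_form (h *: X + Y) Z =
  h * conformal_form X Z + conformal_form Y Z.
Proof. by rewrite /conformal_form metric_linear mulrDr mulrCA. Qed.

Fact conformal_sym X Y : conformal_form X Y = conformal_form Y X.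
Proof. by rewrite /conformal_form metric_sym. Qed.

Fact conformal_pointwise (p : M) (X Y : vfield) :
  (forall h, X h p = 0) -> conformal_form X Y p = 0.
Proof.
move=> X0; change (expR (f p + f p) * g X Y p = 0).
by rewrite (metric_pointwise g Y X0) mulr0.
Qed.

Fact conformal_nondegenerate (p : M) (X : vfield) :
  (forall Y, conformal_form X Y p = 0) -> forall h, X h p = 0.
Proof.
move=> gX0; apply: metric_nondegenerate (g) _ _ _ => Y.
by have /eqP := gX0 Y; rewrite mulf_eq0 gt_eqF ?expR_gt0// => /eqP.
Qed.

Fact conformal_indexP (p : M) : exists E eps,
  orthonormal_basis_at conformal_form p E eps /\
  #|[set i | eps i]%SET| = metric_index g.
Proof.
have [E [eps [[gE spE] card_eps]]] := metric_indexP g p.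
exists (fun i => sexp (- f) *: E i), eps; split => //; split => [i j|v /spE].
  have gZl (h : Cinf) X Y : g (h *: X) Y = h * g X Y.
    have g0 : g 0 Y = 0.
      have := metric_linear g 1 0 0 Y; rewrite scale1r mul1r addr0.
      by move=> /(congr1 (fun u => u - g 0 Y)); rewrite subrr addrK.
    by rewrite -[h *: X]addr0 metric_linear g0 addr0.
  rewrite /conformal_form gZl metric_sym gZl metric_sym.
  rewrite -gE; change (expR (f p + f p) *
    (expR (- f p) * (expR (- f p) * g (E i) (E j) p)) = g (E i) (E j) p).
  by rewrite !mulrA -!expRD addrK subrr expR0 mul1r.
move=> [a va]; exists (fun i => a i * expR (f p)) => h.
rewrite va; apply: eq_bigr => i _.
change (a i * E i h p = a i * expR (f p) * (expR (- f p) * E i h p)).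
by rewrite !mulrA -(mulrA (a i)) -expRD subrr expR0 mulr1.
Qed.

(* The metric e^(2f) g. *)
Definition conformal : metric := Metric conformal_linear conformal_sym
  conformal_pointwise conformal_nondegenerate conformal_indexP.

End conformal_change.

Definition is_gradient (g : metric) (f : Cinf) (G : vfield) : Prop :=
  forall X, g G X = X f.

Record connection := Connection {
  connection_fun :> vfield -> vfield -> vfield ;
  connection_linear : forall (h : Cinf) (X Y Z : vfield),
    connection_fun (h *: X + Y) Z =
    h *: connection_fun X Z + connection_fun Y Z ;
  connection_add : forall X Y Z,
    connection_fun X (Y + Z) = connection_fun X Y + connection_fun X Z ;
  connection_leibniz : forall X (h : Cinf) Y,
    connection_fun X (h *: Y) = X h *: Y + h *: connection_fun X Y }.

(* The Levi-Civita connection of g is the only D satisfying this.            *)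
Definition levi_civita (g : metric) (D : connection) : Prop :=
  (forall X Y : vfield, D X Y - D Y X = bracket X Y) /\
  (forall X Y Z : vfield, X (g Y Z) = g (D X Y) Z + g Y (D X Z)).

Section vectorial_torsion.
Variables (g : metric) (D : connection) (V : vfield).

Definition vectorial_fun (X Y : vfield) : vfield :=
  D X Y + g X Y *: V - g V Y *: X.

Fact vectorial_linear (h : Cinf) (X Y Z : vfield) :
  vectorial_fun (h *: X + Y) Z = h *: vectorial_fun X Z + vectorial_fun Y Z.
Proof.
rewrite /vectorial_fun connection_linear metric_linear scalerBr !scalerDr.
rewrite scalerDl !scalerA opprD [g V Z * h]mulrC.
by rewrite [RHS]addrACA; congr (_ + _); rewrite addrACA.
Qed.

Fact vectorial_add X Y Z :
  vectorial_fun X (Y + Z) = vectorial_fun X Y + vectorial_fun X Z.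
Proof.
have gD A B C : g A (B + C) = g A B + g A C.
  by rewrite metric_sym -{1}[B]scale1r metric_linear mul1r !(metric_sym g A).
rewrite /vectorial_fun connection_add !gD !scalerDl opprD.
by rewrite [RHS]addrACA; congr (_ + _); rewrite addrACA.
Qed.

Fact vectorial_leibniz (X : vfield) (h : Cinf) (Y : vfield) :
  vectorial_fun X (h *: Y) = X h *: Y + h *: vectorial_fun X Y.
Proof.
have gZ A B : g A (h *: B) = h * g A B.
  have := metric_linear g h B 0 A; have := metric_linear g 1 0 0 A.
  rewrite scale1r mul1r addr0 => /(congr1 (fun u => u - g 0 A)).
  by rewrite subrr addrK => <-; rewrite !addr0 !(metric_sym g A).
rewrite /vectorial_fun connection_leibniz !gZ scalerBr scalerDr !scalerA.
by rewrite !addrA.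
Qed.

Definition vectorial_connection : connection :=
  Connection vectorial_linear vectorial_add vectorial_leibniz.

End vectorial_torsion.

Definition curvature (D : connection) (X Y Z : vfield) : vfield :=
  D X (D Y Z) - D Y (D X Z) - D (bracket X Y) Z.

Definition curvature4 (g : metric) (D : connection) (X Y Z W : vfield) : Cinf :=
  g (curvature D X Y Z) W.

(* A choice of an orthonormal basis of T_pM; one exists by [metric_indexP].  *)
Definition onb (g : metric) (p : M) : ('I_n -> vfield) * ('I_n -> bool) :=
  xget (fun=> 0, fun=> false) [set F | orthonormal_basis_at g p F.1 F.2].

(* Ric(X, Y) and s are functions on M, computed at p with [onb g p]; the      *)
(* result does not depend on the chosen basis.                                *)
Definition ricci (g : metric) (D : connection) (X Y : vfield) (p : M) : R :=
  let: (E, eps) := onb g p in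
  \sum_i (-1) ^+ eps i * g (curvature D X (E i) (E i)) Y p.

Definition scalar_curvature (g : metric) (D : connection) (p : M) : R :=
  let: (E, eps) := onb g p in
  \sum_i (-1) ^+ eps i * ricci g D (E i) (E i) p.

Definition flat (D : connection) : Prop :=
  forall X Y Z, curvature D X Y Z = 0.

Definition ricci_flat (g : metric) (D : connection) : Prop :=
  forall X Y p, ricci g D X Y p = 0.

Definition einstein (g : metric) (D : connection) : Prop :=
  exists lambda : Cinf, forall X Y p, ricci g D X Y p = lambda p * g X Y p.

End vector_fields.

(* Main.v *)
(* The Levi-Civita connection of e^(2f) g is nabla_X Y + X(f) Y, as the right  *)
(* side is torsion-free and compatible with e^(2f) g. It differs from nabla by *)
(* the exact form df times the identity, so both have the same curvature      *)
(* endomorphism. The traces agree because the trace of a C^oo-bilinear form   *)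
(* over an orthonormal basis depends on the metric only; the chosen bases for *)
(* g and e^(2f) g contribute the factor e^(2f).                               *)

From HB Require Import structures.
From mathcomp Require Import all_boot all_order all_algebra.
From mathcomp Require Import all_classical all_reals all_analysis.
From mathcomp Require Import ring.
Require Import Defs.
Import Order.TTheory GRing.Theory Num.Theory.
Import numFieldNormedType.Exports.
Local Open Scope ring_scope.

Set Implicit Arguments.
Unset Strict Implicit.
Unset Printing Implicit Defensive.

(** The Levi-Civita connection of e^(2f) g is [DV] plus df times the identity
    ([conformal_levi_civita]). As d(df) = 0, both connections have the same curvature endomorphism
    ([curvature_add_exact]), and lowering it with the two metrics gives the factor e^(-2f). In Ric
    this factor cancels against that of the trace ([trace_conformal]); in s a second trace leaves
    e^(2f). Since vector fields are abstract derivations, two facts need an algebraic proof: X(e^u)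
    = e^u X(u) ([vfield_sexp]), through a power series, and the expansion at p of a C^oo-linear form
    in a basis orthonormal only at p ([orthonormal_expansion]), through Cramer's rule. *)

(** * Power series with coefficients bounded by those of exp *)

Section EntireSeries.
Variable R : realType.
Implicit Types (c : R^nat) (x : R).

(** This bound gives convergence everywhere and survives termwise differentiation, so a single class
    contains all derivatives. *)
Definition exp_dominated c := forall i, `|c i| <= (i`!%:R)^-1.

Lemma exp_dominated_diffs c : exp_dominated c -> exp_dominated (pseries_diffs c).
Proof.
move=> hc i; rewrite /pseries_diffs normrM ger0_norm//.
have := hc i.+1; rewrite factS natrM invfM => /(ler_wpM2l (ler0n R i.+1)).
by rewrite mulVKf.
Qed.

Lemma exp_dominated_cvg c x : exp_dominated c -> cvgn (pseries c x).
Proof.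
move=> hc; apply: normed_cvg.
apply: series_le_cvg (is_cvg_series_exp_coeff `|x|) => i //=.
  by rewrite exp_coeff_ge0.
by rewrite normrM normrX /exp_coeff /= mulrC ler_wpM2l// exprn_ge0.
Qed.

Definition power_sum c x : R := limn (pseries c x).

Lemma is_derive_power_sum c x : exp_dominated c ->
  is_derive x (1 : R) (power_sum c) (power_sum (pseries_diffs c) x).
Proof.
move=> hc; have hc' := exp_dominated_diffs hc.
have hc'' := exp_dominated_diffs hc'.
(* Any radius beyond the absolute value of x would do. *)
apply: (@pseries_snd_diffs _ c (`|x| + 1)); try exact: exp_dominated_cvg.
by rewrite [ltRHS]ger0_norm ?addr_ge0// ltrDl ltr01.
Qed.

Lemma continuous_power_sum c x : exp_dominated c ->
  {for x, continuous (power_sum c)}.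
Proof.
move=> hc; apply: differentiable_continuous; apply/derivable1_diffP.
by have [] := is_derive_power_sum x hc.
Qed.

(* The coefficients of t |-> (exp t - 1) / t, continued by 1 at 0. *)
Definition expm1_coeff : R^nat := fun i => (i.+1`!%:R)^-1.

Lemma expm1_dominated : exp_dominated expm1_coeff.
Proof.
move=> i; rewrite ger0_norm ?invr_ge0 ?ler0n// lef_pV2 ?posrE ?ltr0n ?fact_gt0//.
by rewrite ler_nat factS leq_pmull.
Qed.

Lemma expRE_expm1 x : expR x = 1 + x * power_sum expm1_coeff x.
Proof.
apply/cvg_lim => //; rewrite -cvg_shiftS.
rewrite (_ : [sequence _]_n = fun n => 1 + x * pseries expm1_coeff x n).
  apply: cvgD; first exact: cvg_cst.
  by apply: cvgMr; exact: exp_dominated_cvg expm1_dominated.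
apply/funext => n /=; rewrite /series /pseries /= /series /= big_nat_recl//.
rewrite /exp_coeff /= expr0 fact0 divr1 big_distrr; congr (_ + _).
by apply: eq_bigr => i _; rewrite /expm1_coeff /= exprS -mulrA [X in x * X]mulrC.
Qed.

Lemma power_sum_expm1_0 : power_sum expm1_coeff 0 = 1.
Proof.
apply/cvg_lim => //; rewrite -cvg_shiftS.
rewrite (_ : [sequence _]_n = cst 1); first exact: cvg_cst.
apply/funext => n /=; rewrite /pseries /series /= big_nat_recl//.
rewrite /expm1_coeff expr0 invr1 mulr1 big1 ?addr0// => i _.
by rewrite exprS mul0r mulr0.
Qed.

End EntireSeries.

(** * Such series composed with C^k functions *)

Section SmoothComposition.
Variables (R : realType) (n : nat).
Implicit Types (U : set 'rV[R]_n) (h : 'rV[R]_n -> R).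

(** Along the line t |-> x + t v the difference quotients are those of a function of t, so the
    one-variable chain rule applies. *)
Lemma is_derive_comp h (phi : R -> R) (x v : 'rV[R]_n) (d d' : R) :
  is_derive x v h d -> is_derive (h x) 1 phi d' ->
  is_derive x v (phi \o h) (d' * d).
Proof.
move=> [hd <-] phid.
pose l (t : R) := h (t *: v + x).
have l0 : l 0 = h x by rewrite /l scale0r add0r.
have lineE (F : R -> R) (G : 'rV[R]_n -> R) :
    (forall t, F t = G (t *: v + x)) ->
    (fun t : R => t^-1 *: ((F \o shift 0) (t *: (1 : R)) - F 0)) =
    (fun t : R => t^-1 *: ((G \o shift x) (t *: v) - G x)).
  move=> FG; apply/funext => t.
  by rewrite /= !FG scale0r add0r addr0 /GRing.scale /= mulr1.
have ld : is_derive (0 : R) (1 : R) l ('D_v h x).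
  by split; rewrite ?/derivable ?/derive (lineE l h).
have [ed eE] : is_derive (0 : R) (1 : R) (phi \o l) (d' * 'D_v h x).
  by apply: is_derive1_comp; rewrite l0.
by split; [move: ed; rewrite /derivable|move: eE; rewrite /derive];
  rewrite (lineE (phi \o l) (phi \o h)).
Qed.

Lemma Ck_power_sum k U h (c : R^nat) :
  exp_dominated c -> Ck k U h -> Ck k U (power_sum c \o h).
Proof.
elim: k h c => [|k IHk] h c hc C.
  split=> // x Ux; apply: continuous_comp; first exact: (C.1 x).
  exact: continuous_power_sum.
split=> [x Ux|i].
  by apply: continuous_comp; [exact: (C.1 x)|exact: continuous_power_sum].
have [dh dhE C'] := C.2 i.
exists ((power_sum (pseries_diffs c) \o h) * dh).
  move=> x Ux; apply: is_derive_comp; first exact: dhE.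
  exact: is_derive_power_sum.
by apply: CkM => //; apply: IHk (exp_dominated_diffs hc) _; exact: CkW.
Qed.

End SmoothComposition.

(** * Derivations of C^oo(M) and the exponential *)

Section Derivations.
Variables (R : realType) (n : nat) (M : manifold R n).
Local Notation Cinf := (smoothfun M).
Implicit Types (X Y Z W : vfield M) (f h u : Cinf) (p q : M).

(** A named evaluation can carry the ring morphism structure, which moves sums and determinants to
    the point p. *)
Definition evalp p h : R := h p.

Fact evalp_is_zmod_morphism p : zmod_morphism (evalp p). Proof. by []. Qed.
HB.instance Definition _ p :=
  GRing.isZmodMorphism.Build Cinf R (evalp p) (evalp_is_zmod_morphism p).
Fact evalp_is_monoid_morphism p : monoid_morphism (evalp p). Proof. by []. Qed.
HB.instance Definition _ p :=
  GRing.isMonoidMorphism.Build Cinf R (evalp p) (evalp_is_monoid_morphism p).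

Lemma evalpE p h : h p = evalp p h. Proof. by []. Qed.

Lemma vfield_funD X h u : X (h + u) = X h + X u.
Proof. by rewrite -{1}[h]scale1r vfield_linear scale1r. Qed.

Lemma vfield_fun0 X : X 0 = 0.
Proof. by apply: (addrI (X 0)); rewrite -vfield_funD !addr0. Qed.

Lemma vfield_scale X (a : R) h : X (a *: h) = a *: X h.
Proof. by rewrite -[a *: h]addr0 vfield_linear vfield_fun0 addr0. Qed.

Lemma vfield_cst X (a : R) : X (a *: (1 : Cinf)) = 0.
Proof.
suff X1 : X 1 = 0 by rewrite vfield_scale X1 scaler0.
have := vfield_leibniz X 1 1; rewrite !mulr1 mul1r => /(congr1 (+%R^~ (- X 1))).
by rewrite subrr addrK.
Qed.

(* Hadamard's trick: exp w = 1 + w * psi(w) with psi(0) = 1, applied to      *)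
(* w = u - u(p), lets the derivation see exp u through the Leibniz rule.      *)
Lemma vfield_sexp X u : X (sexp u) = sexp u * X u.
Proof.
apply/val_inj/funext => p.
pose w : Cinf := u - u p *: (1 : Cinf).
have psiP : (power_sum (expm1_coeff R) \o w) \in @smooth R n M.
  apply/asboolP => c Ac k.
  apply: (@Ck_power_sum _ _ k _ (w \o chart_inv c) _ (@expm1_dominated R)).
  by have /asboolP := smoothfunP w; exact.
have sexpE : sexp u = expR (u p) *: (1 + w * SmoothFun psiP).
  apply/val_inj/funext => q.
  change (expR (u q) = expR (u p) *
    (1 + (u q - u p * 1) * power_sum (expm1_coeff R) (u q - u p * 1))).
  by rewrite -expRE_expm1 -expRD mulr1 subrKC.
have X1 : X 1 = 0 by rewrite -[1 in LHS]scale1r vfield_cst.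
have Xw : X w = X u by rewrite /w vfield_funD -scaleNr vfield_cst addr0.
rewrite {1}sexpE vfield_scale vfield_funD X1 vfield_leibniz Xw.
change (expR (u p) * (0 + (X u p * power_sum (expm1_coeff R) (u p - u p * 1)
  + (u p - u p * 1) * X (SmoothFun psiP) p)) = expR (u p) * X u p).
by rewrite mulr1 subrr power_sum_expm1_0 mul0r addr0 mulr1 add0r.
Qed.

Lemma sexpN_mul (u h : Cinf) : sexp (- u) * (sexp u * h) = h.
Proof.
apply/val_inj/funext => p; change (expR (- u p) * (expR (u p) * h p) = h p).
by rewrite mulrA -expRD addNr expR0 mul1r.
Qed.

End Derivations.

(** * C^oo-linear forms and orthonormal expansions *)

Section Metric.
Variables (R : realType) (n : nat) (M : manifold R n).
Local Notation Cinf := (smoothfun M).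
Implicit Types (X Y Z W : vfield M) (f h u : Cinf) (p q : M).

Definition tensorial (T : vfield M -> Cinf) : Prop :=
  forall h X Y, T (h *: X + Y) = h * T X + T Y.

Section TensorialTheory.
Variables (T : vfield M -> Cinf) (hT : tensorial T).

Lemma tensorial0 : T 0 = 0.
Proof.
have := hT 1 0 0; rewrite scale1r addr0 mul1r => /(congr1 (+%R^~ (- T 0))).
by rewrite subrr addrK.
Qed.

Lemma tensorialZ h X : T (h *: X) = h * T X.
Proof. by rewrite -[h *: X]addr0 hT tensorial0 addr0. Qed.

Lemma tensorialD X Y : T (X + Y) = T X + T Y.
Proof. by rewrite -[X]scale1r hT mul1r scale1r. Qed.

Lemma tensorialN X : T (- X) = - T X.
Proof. by rewrite -scaleN1r tensorialZ mulN1r. Qed.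

Lemma tensorialB X Y : T (X - Y) = T X - T Y.
Proof. by rewrite tensorialD tensorialN. Qed.

Lemma tensorial_sum (I : finType) (c : I -> Cinf) (E : I -> vfield M) :
  T (\sum_i c i *: E i) = \sum_i c i * T (E i).
Proof.
elim/big_rec2: _ => [|i _ v _ <-]; first exact: tensorial0.
exact: hT.
Qed.

End TensorialTheory.

Variable g : metric M.

Lemma metric_tensorial Z : tensorial (g^~ Z).
Proof. by move=> h X Y; exact: metric_linear. Qed.

Lemma metric_tensorialr Z : tensorial (g Z).
Proof. by move=> h X Y; rewrite !(metric_sym g Z) metric_linear. Qed.

Lemma metric_inj X Y : (forall Z, g X Z = g Y Z) -> X = Y.
Proof.
move=> gXY; apply/vfield_eqP => h; apply/val_inj/funext => p.
apply/eqP; rewrite -subr_eq0; apply/eqP.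
apply: (@metric_nondegenerate _ _ _ g p (X - Y)) => Z.
by rewrite (tensorialB (metric_tensorial Z)) gXY subrr.
Qed.

Lemma vfield_sumE (I : finType) (X : I -> vfield M) h :
  (\sum_i X i) h = \sum_i X i h.
Proof. by elim/big_rec2: _ => [|i u v _ <-]. Qed.

Lemma smooth_mulE h u p : (h * u) p = h p * u p. Proof. by []. Qed.

Lemma smooth_sumE (I : finType) (u : I -> Cinf) p :
  (\sum_i u i) p = \sum_i u i p.
Proof. by rewrite evalpE rmorph_sum. Qed.

(** Extending the numbers a_i as constant functions gives a global field Y that vanishes at p, to
    which [metric_pointwise] applies. *)
Lemma metric_at_sum p (I : finType) (a : I -> R) (E : I -> vfield M) X Z :
    (forall h, X h p = \sum_i a i * E i h p) ->
  g X Z p = \sum_i a i * g (E i) Z p.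
Proof.
move=> XE; pose Y := X - \sum_i (a i *: (1 : Cinf)) *: E i.
have : g Y Z p = 0.
  apply: metric_pointwise => h.
  change (X h p - (\sum_i (a i *: (1 : Cinf)) *: E i) h p = 0).
  rewrite vfield_sumE smooth_sumE XE -sumrB big1// => i _.
  by change (a i * E i h p - a i * 1 * E i h p = 0); rewrite mulr1 subrr.
rewrite (tensorialB (metric_tensorial Z)) (tensorial_sum (metric_tensorial Z)).
set s := \sum_i _; move=> gY0; apply/eqP; rewrite -subr_eq0 -[X in _ - X](_ : s p = _).
  exact/eqP.
rewrite /s smooth_sumE; apply: eq_bigr => i _.
by change (a i * 1 * g (E i) Z p = a i * g (E i) Z p); rewrite mulr1.
Qed.

Lemma vfield_tangent_at X p : tangent_at p (fun h => X h p).
Proof.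
by split=> [a f h|f h]; [rewrite vfield_linear|rewrite vfield_leibniz].
Qed.

(* The Gram matrix of E at p is A *m K, where A expresses E in an orthonormal *)
(* basis F at p; hence A is invertible and W is orthogonal to F as well.      *)
Lemma vanishing_at p (E : 'I_n -> vfield M) W :
    \det (\matrix_(i, j) g (E i) (E j)) p != 0 ->
    (forall i, g W (E i) p = 0) ->
  forall h, W h p = 0.
Proof.
move=> detE gW0; have [F [eps [[_ spF] _]]] := metric_indexP g p.
have /choice[a aE] : forall i, exists a : 'I_n -> R,
    forall h, E i h p = \sum_k a k * F k h p.
  by move=> i; apply: spF; exact: vfield_tangent_at.
pose A : 'M[R]_n := \matrix_(i, k) a i k.
have detA : \det A != 0.
  apply: contraNneq detE => detA0.
  rewrite evalpE -det_map_mx (_ : map_mx _ _ =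
      A *m \matrix_(k, j) g (F k) (E j) p); first by rewrite det_mulmx detA0 mul0r.
  apply/matrixP => i j; rewrite !mxE /= -evalpE (metric_at_sum _ (aE i)).
  by apply: eq_bigr => k _; rewrite !mxE.
have gWF k : g W (F k) p = 0.
  pose w : 'cV[R]_n := \col_k g W (F k) p.
  suff w0 : w = 0 by have /matrixP/(_ k 0) := w0; rewrite !mxE.
  have Aw0 : A *m w = 0.
    apply/matrixP => i j; have := gW0 i.
    rewrite metric_sym (metric_at_sum _ (aE i)) !mxE => gE0.
    by rewrite -[RHS]gE0; apply: eq_bigr => k' _; rewrite !mxE metric_sym.
  have uA : A \in unitmx by rewrite unitmxE unitfE.
  by rewrite -(mulKmx uA w) Aw0 mulmx0.
apply: (@metric_nondegenerate _ _ _ g) => Z.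
have [b /= bE] := spF _ (vfield_tangent_at Z p).
rewrite metric_sym (metric_at_sum _ bE) big1// => k _.
by rewrite metric_sym gWF mulr0.
Qed.

(* Cramer's rule for the Gram matrix of E with determinant d: the field       *)
(* d Y - sum_i c_i E_i is orthogonal to all E_k, so it vanishes wherever d    *)
(* does not, and d times it vanishes globally; no cut-off function is needed. *)
Lemma orthonormal_expansion p (E : 'I_n -> vfield M) eps T Y :
    orthonormal_basis_at g p E eps -> tensorial T ->
  T Y p = \sum_i (-1) ^+ eps i * g Y (E i) p * T (E i) p.
Proof.
move=> [gE _] hT.
pose G : 'M[Cinf]_n := \matrix_(i, j) g (E i) (E j).
pose y : 'rV[Cinf]_n := \row_j g Y (E j).
pose d : Cinf := \det G; pose c := y *m \adj G.
have cG : c *m G = d *: y by rewrite -mulmxA mul_adj_mx mul_mx_scalar.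
clearbody c.
pose W := d *: Y - \sum_i c 0 i *: E i.
have gW k : g W (E k) = 0.
  rewrite (tensorialB (metric_tensorial _)) (tensorialZ (metric_tensorial _)).
  rewrite (tensorial_sum (metric_tensorial _)).
  have /matrixP/(_ 0 k) := cG; rewrite !mxE => <-.
  apply/eqP; rewrite subr_eq0; apply/eqP.
  by apply: eq_bigr => i _; rewrite !mxE.
have dW0 : d *: W = 0.
  apply/vfield_eqP => h; apply/val_inj/funext => q.
  change (d q * W h q = 0).
  have [->|dq] := eqVneq (d q) 0; first by rewrite mul0r.
  by rewrite (@vanishing_at q E W dq) ?mulr0// => i; rewrite gW.
pose eta i : R := (-1) ^+ eps i.
have eta2 i : eta i * eta i = 1 by rewrite -expr2 sqrr_sign.
have Gp i j : G i j p = if i == j then eta i else 0 by rewrite !mxE gE.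
have dp : d p != 0.
  rewrite evalpE -det_map_mx (_ : map_mx _ _ = diag_mx (\row_i eta i)).
    rewrite det_diag; apply/prodf_neq0 => i _; rewrite mxE.
    by rewrite -sqrf_eq0 expr2 eta2 oner_eq0.
  apply/matrixP => i j; rewrite !mxE /= -evalpE gE.
  by case: eqP => //= ->; rewrite mulr1n.
(* The Gram matrix is diagonal at p with entries eta_i, each its own inverse. *)
have cp i : c 0 i p = d p * (eta i * g Y (E i) p).
  have /matrixP/(_ 0 i)/(congr1 (evalp p)) := cG.
  rewrite !mxE -!evalpE smooth_sumE smooth_mulE.
  rewrite (bigD1 i)// big1 ?Monoid.mulm1 => [|k /andP[_ ki]]; last first.
    by rewrite smooth_mulE Gp (negbTE ki) mulr0.
  rewrite smooth_mulE Gp eqxx => ci.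
  by rewrite mulrCA -ci mulrCA eta2 mulr1.
have : T (d *: W) p = 0 by rewrite dW0 (tensorial0 hT).
rewrite (tensorialZ hT) (tensorialB hT) (tensorialZ hT) (tensorial_sum hT).
set s := \sum_i _ => dW; have {dW} : d p * (d p * T Y p - s p) = 0 by [].
move=> /eqP; rewrite mulf_eq0 (negbTE dp)/= subr_eq0 => /eqP dTY.
apply: (mulfI dp); rewrite dTY /s smooth_sumE mulr_sumr; apply: eq_bigr => i _.
by change (c 0 i p * T (E i) p = d p * (eta i * g Y (E i) p * T (E i) p));
  rewrite cp -mulrA.
Qed.

End Metric.

(** * Tensoriality of curvature, uniqueness of Levi-Civita *)

Section Curvature.
Variables (R : realType) (n : nat) (M : manifold R n).
Local Notation Cinf := (smoothfun M).
Implicit Types (X Y Z W : vfield M) (f h u : Cinf) (p q : M) (D : connection M).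

Lemma connection0 D Y : D 0 Y = 0.
Proof.
have := connection_linear D 1 0 0 Y; rewrite !scale1r addr0.
by move=> /(congr1 (+%R^~ (- D 0 Y))); rewrite subrr addrK.
Qed.

Lemma connectionZ D h X Y : D (h *: X) Y = h *: D X Y.
Proof. by rewrite -[h *: X]addr0 connection_linear connection0 addr0. Qed.

Lemma connectionD D X Y Z : D (X + Y) Z = D X Z + D Y Z.
Proof. by rewrite -{1}[X]scale1r connection_linear scale1r. Qed.

Lemma connectionN D X Y : D (- X) Y = - D X Y.
Proof. by rewrite -scaleN1r connectionZ scaleN1r. Qed.

Lemma vfield_addE X Y h : (X + Y) h = X h + Y h. Proof. by []. Qed.
Lemma vfield_oppE X h : (- X) h = - X h. Proof. by []. Qed.
Lemma vfield_scaleE u X h : (u *: X) h = u * X h. Proof. by []. Qed.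
Definition vfieldE := (vfield_addE, vfield_oppE, vfield_scaleE).

Lemma bracket_linearr X h Y Z :
  bracket X (h *: Y + Z) = h *: bracket X Y + X h *: Y + bracket X Z.
Proof.
apply/vfield_eqP => u; rewrite !vfieldE.
change (X (h * Y u + Z u) - (h * Y (X u) + Z (X u)) =
  h * (X (Y u) - Y (X u)) + X h * Y u + (X (Z u) - Z (X u))).
by rewrite vfield_funD vfield_leibniz; ring.
Qed.

Lemma curvature_anti D X Y Z : curvature D Y X Z = - curvature D X Y Z.
Proof.
rewrite /curvature (_ : bracket Y X = - bracket X Y); last first.
  by apply/vfield_eqP => u; rewrite vfieldE /= opprB.
by rewrite connectionN; apply/vfield_eqP => u; rewrite !vfieldE; ring.
Qed.

Lemma curvature_linear2 D X Z h Y Y' :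
  curvature D X (h *: Y + Y') Z = h *: curvature D X Y Z + curvature D X Y' Z.
Proof.
rewrite /curvature bracket_linearr !(connectionD, connectionZ).
rewrite connection_add connection_leibniz.
by apply/vfield_eqP => u; rewrite !vfieldE; ring.
Qed.

Lemma curvature_linear1 D Y Z h X X' :
  curvature D (h *: X + X') Y Z = h *: curvature D X Y Z + curvature D X' Y Z.
Proof.
by rewrite !(curvature_anti D Y) curvature_linear2 opprD scalerN.
Qed.

(** The first-order terms in h cancel in pairs; the second-order ones are X(Y h) - Y(X h), which the
    bracket term removes. *)
Lemma curvature_linear3 D X Y h Z Z' :
  curvature D X Y (h *: Z + Z') = h *: curvature D X Y Z + curvature D X Y Z'.
Proof.
rewrite /curvature !(connection_add, connection_leibniz).
apply/vfield_eqP => u; rewrite !vfieldE.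
by rewrite (_ : bracket X Y h = X (Y h) - Y (X h))//; ring.
Qed.

Lemma curvature4_tensorial1 (g : metric M) D Y Z W :
  tensorial (fun X => curvature4 g D X Y Z W).
Proof. by move=> h X X'; rewrite /curvature4 curvature_linear1 metric_linear. Qed.

Lemma curvature4_tensorial2 (g : metric M) D X Z W :
  tensorial (fun Y => curvature4 g D X Y Z W).
Proof. by move=> h Y Y'; rewrite /curvature4 curvature_linear2 metric_linear. Qed.

Lemma curvature4_tensorial3 (g : metric M) D X Y W :
  tensorial (fun Z => curvature4 g D X Y Z W).
Proof. by move=> h Z Z'; rewrite /curvature4 curvature_linear3 metric_linear. Qed.

Lemma curvature4_tensorial4 (g : metric M) D X Y Z :
  tensorial (curvature4 g D X Y Z).
Proof. exact: metric_tensorialr. Qed.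

Lemma onbP (g : metric M) p : orthonormal_basis_at g p (onb g p).1 (onb g p).2.
Proof.
have [E [eps [hE _]]] := metric_indexP g p.
by rewrite /onb; case: xgetP => [F -> //|/(_ (E, eps))].
Qed.

Lemma ricciE (g : metric M) D X Y p :
  ricci g D X Y p = \sum_i (-1) ^+ (onb g p).2 i *
    curvature4 g D X ((onb g p).1 i) ((onb g p).1 i) Y p.
Proof. by rewrite /ricci; case: (onb g p). Qed.

Lemma scalar_curvatureE (g : metric M) D p :
  scalar_curvature g D p = \sum_i (-1) ^+ (onb g p).2 i *
    ricci g D ((onb g p).1 i) ((onb g p).1 i) p.
Proof. by rewrite /scalar_curvature; case: (onb g p). Qed.

(** Multiples of the identity commute with everything, so only d(df) times Z could remain, and X(Y
    f) - Y(X f) = [X, Y] f makes it zero. *)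
Lemma curvature_add_exact D D' f :
    (forall X Y, D' X Y = D X Y + X f *: Y) ->
  forall X Y Z, curvature D' X Y Z = curvature D X Y Z.
Proof.
move=> D'E X Y Z; rewrite /curvature !D'E !(connection_add, connection_leibniz).
apply/vfield_eqP => u; rewrite !vfieldE.
by rewrite (_ : bracket X Y f = X (Y f) - Y (X f))//; ring.
Qed.

(* Koszul's trick: for S = D - D', g(S(X,Y),Z) is symmetric in X, Y and      *)
(* antisymmetric in Y, Z.                                                     *)
Lemma levi_civita_unique (D D' : connection M) (g' : metric M) :
  levi_civita g' D -> levi_civita g' D' -> forall X Y, D X Y = D' X Y.
Proof.
move=> [tor comp] [tor' comp'] X0 Y0.
pose S X Y := D X Y - D' X Y.
have gB X Y Z : g' (X - Y) Z = g' X Z - g' Y Z.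
  exact: (tensorialB (metric_tensorial g' Z)).
have SC X Y : S X Y = S Y X.
  have DE : D X Y = D Y X + bracket X Y by rewrite -tor subrKC.
  have DE' : D' X Y = D' Y X + bracket X Y by rewrite -tor' subrKC.
  by rewrite /S DE DE' opprD addrACA subrr addr0.
have SA X Y Z : g' (S X Y) Z = - g' (S X Z) Y.
  have := comp X Y Z; rewrite comp' !(metric_sym g' Y) !gB.
  move=> /(congr1 (+%R^~ (- g' (D X Z) Y))); rewrite addrK => <-; ring.
apply: (@metric_inj _ _ _ g') => Z; apply/val_inj/funext => p.
apply/eqP; rewrite -subr_eq0.
have : g' (S X0 Y0) Z = - g' (S X0 Y0) Z.
  rewrite {1}(SA X0 Y0 Z) (SC X0 Z) (SA Z X0 Y0) opprK (SC Z Y0) (SA Y0 Z X0).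
  by rewrite (SC Y0 X0).
rewrite gB => /(congr1 (evalp p)); rewrite /evalp.
set a := g' (D X0 Y0) Z; set b := g' (D' X0 Y0) Z.
have -> : - (a - b) = b - a by rewrite opprB.
change (a p - b p = b p - a p -> a p - b p == 0) => ab.
suff : 2 * (a p - b p) == 0 by rewrite mulf_eq0 pnatr_eq0.
by rewrite mulr_natl mulr2n {1}ab; apply/eqP; ring.
Qed.

End Curvature.

(** * Traces and connections under conformal change *)

Section ConformalChange.
Variables (R : realType) (n : nat) (M : manifold R n).
Local Notation Cinf := (smoothfun M).
Variables (f : Cinf) (g : metric M).
Implicit Types (X Y Z W : vfield M) (p : M).

Local Notation gt := (conformal f g).

Lemma conformalE X Y : gt X Y = sexp (f *+ 2) * g X Y. Proof. by []. Qed.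

Lemma conformalE_at X Y p : gt X Y p = expR (2 * f p) * g X Y p.
Proof. by rewrite mulr_natl. Qed.

(** Expand the first E_i of B(E_i, E_i) in F and the second F_k of B(F_k, F_k) in E: both sides
    become the same double sum of B(F_k, E_i), up to the ratio of the metrics. *)
Lemma trace_conformal p (E F : 'I_n -> vfield M) eps eta
    (B : vfield M -> vfield M -> Cinf) :
    orthonormal_basis_at g p E eps -> orthonormal_basis_at gt p F eta ->
    (forall Y, tensorial (B^~ Y)) -> (forall X, tensorial (B X)) ->
  \sum_i (-1) ^+ eps i * B (E i) (E i) p =
  expR (2 * f p) * \sum_k (-1) ^+ eta k * B (F k) (F k) p.
Proof.
move=> hE hF B1 B2.
under eq_bigr => i _.
  rewrite (orthonormal_expansion (E i) hF (B1 (E i))) mulr_sumr; over.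
rewrite exchange_big mulr_sumr; apply: eq_bigr => k _.
rewrite (orthonormal_expansion (F k) hE (B2 (F k))) !mulr_sumr.
apply: eq_bigr => i _.
rewrite conformalE_at (metric_sym g (E i)).
by rewrite !mulrA; congr (_ * _ * _); ring.
Qed.

Variables (grad_f : vfield M) (hgrad : is_gradient g f grad_f).
Variables (D Dt : connection M).
Hypotheses (hD : levi_civita g D) (hDt : levi_civita gt Dt).
Local Notation DV := (vectorial_connection g D (- grad_f)).

(** The terms added to [D] are symmetric in X and Y, so the torsion stays zero. In the compatibility
    condition the two X(f) terms match the derivative of e^(2f), and the gradient terms cancel
    against those in Y(f) X. *)
Lemma conformal_levi_civita X Y : Dt X Y = DV X Y + X f *: Y.
Proof.
have gN Z : g (- grad_f) Z = - Z f.
  by rewrite (tensorialN (metric_tensorial g Z)) hgrad.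
pose L_fun X Y := DV X Y + X f *: Y.
have Llin (h : Cinf) A B Z : L_fun (h *: A + B) Z = h *: L_fun A Z + L_fun B Z.
  rewrite /L_fun connection_linear; apply/vfield_eqP => u; rewrite !vfieldE; ring.
have Ladd A B C : L_fun A (B + C) = L_fun A B + L_fun A C.
  rewrite /L_fun connection_add; apply/vfield_eqP => u; rewrite !vfieldE; ring.
have Lleib A (h : Cinf) B : L_fun A (h *: B) = A h *: B + h *: L_fun A B.
  rewrite /L_fun connection_leibniz; apply/vfield_eqP => u; rewrite !vfieldE; ring.
pose L := Connection Llin Ladd Lleib.
apply: (@levi_civita_unique _ _ _ Dt L gt) => //.
have [tor comp] := hD.
have LE A B : L A B = D A B - g A B *: grad_f + B f *: A + A f *: B.
  by rewrite /= /L_fun /= /vectorial_fun gN scaleNr opprK scalerN.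
split=> [A B|A B C].
  rewrite -tor !LE (metric_sym g B).
  apply/vfield_eqP => u; rewrite !vfieldE; ring.
have gtT Z := metric_tensorial g Z.
have gtTr Z := metric_tensorialr g Z.
rewrite !conformalE vfield_leibniz vfield_sexp comp vfield_funD !LE.
rewrite !(tensorialD (gtT _), tensorialD (gtTr _), tensorialN (gtT _),
  tensorialN (gtTr _), tensorialZ (gtT _), tensorialZ (gtTr _)).
rewrite !(metric_sym g _ grad_f) !hgrad (metric_sym g B A) mulr2n; ring.
Qed.

End ConformalChange.

Theorem proposition3p5 (R : realType) (n : nat) (M : manifold R n)
    (g : metric M) (f : smoothfun M)
    (grad_f : vfield M) (hgrad : is_gradient g f grad_f)
    (D Dt : connection M)
    (hD : levi_civita g D) (hDt : levi_civita (conformal f g) Dt) :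
  let V := - grad_f in
  let gt := conformal f g in
  let DV := vectorial_connection g D V in
  [/\ forall X Y Z W : vfield M,
        curvature4 g DV X Y Z W = sexp (- (f *+ 2)) * curvature4 gt Dt X Y Z W,
      forall (X Y : vfield M) (p : M), ricci g DV X Y p = ricci gt Dt X Y p
    & forall p : M,
        scalar_curvature g DV p = expR (2 * f p) * scalar_curvature gt Dt p] /\
  [/\ flat DV <-> flat Dt,
      einstein g DV <-> einstein gt Dt
    & ricci_flat g DV <-> ricci_flat gt Dt].
Proof.
move=> V gt DV.
have RE X Y Z : curvature Dt X Y Z = curvature DV X Y Z.
  exact: (curvature_add_exact (conformal_levi_civita hgrad hD hDt)).
have R4 X Y Z W :
    curvature4 gt Dt X Y Z W = sexp (f *+ 2) * curvature4 g DV X Y Z W.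
  by rewrite /curvature4 RE.
have R4p X Y Z W p :
    curvature4 gt Dt X Y Z W p = expR (2 * f p) * curvature4 g DV X Y Z W p.
  by rewrite /curvature4 RE conformalE_at.
have RicE X Y p : ricci g DV X Y p = ricci gt Dt X Y p.
  rewrite !ricciE (trace_conformal (B := fun A C => curvature4 g DV X A C Y)
    (onbP g p) (onbP gt p)); last 2 first.
  - by move=> Z; exact: curvature4_tensorial2.
  - by move=> Z; exact: curvature4_tensorial3.
  by rewrite mulr_sumr; apply: eq_bigr => i _; rewrite R4p mulrCA.
split; split => //.
- by move=> X Y Z W; rewrite R4 sexpN_mul.
- move=> p; rewrite !scalar_curvatureE.
  (* Freezing the basis chosen at p yields a smooth bilinear form that agrees with Ric at p, as the
     trace lemma requires; [ricci] itself is only a function to R. *)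
  pose ric X Y : smoothfun M := \sum_i (-1) ^+ (onb g p).2 i *:
    curvature4 g DV X ((onb g p).1 i) ((onb g p).1 i) Y.
  have ricp X Y : ricci g DV X Y p = ric X Y p by rewrite ricciE smooth_sumE.
  under eq_bigr do rewrite ricp.
  under [in RHS]eq_bigr do rewrite -RicE ricp.
  have ricT (c : 'I_n -> R) (T : 'I_n -> vfield M -> smoothfun M) :
      (forall i, tensorial (T i)) -> tensorial (fun X => \sum_i c i *: T i X).
    move=> hT h X Y; rewrite mulr_sumr -big_split; apply: eq_bigr => i _ /=.
    by rewrite hT scalerDr smooth_scaleAr.
  apply: (trace_conformal (onbP g p) (onbP gt p)) => [Y|X].
  + by apply: ricT => i; exact: curvature4_tensorial1.
  + by apply: ricT => i; exact: curvature4_tensorial4.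
- by split=> h X Y Z; [rewrite RE|rewrite -RE]; exact: h.
- split=> -[l hl].
  (* The Einstein factor absorbs the ratio of the two metrics. *)
  + exists (sexp (- (f *+ 2)) * l) => X Y p; rewrite -RicE hl.
    by rewrite -!smooth_mulE conformalE [sexp _ * l]mulrC -mulrA sexpN_mul.
  + exists (sexp (f *+ 2) * l) => X Y p; rewrite RicE hl.
    by rewrite -!smooth_mulE conformalE mulrCA mulrA.
- by split=> h X Y p; [rewrite -RicE|rewrite RicE]; exact: h.
Qed.
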